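(* Let $p\in\mathbb{R}$, and for a nonempty set $\Omega\subset\mathbb{R}$ that is a finite union of bounded open intervals whose closures are pairwise disjoint, consider the inequality $$ (\ast)\qquad \left(\frac{\mathcal{L}^1(\Omega)}{2}\right)^p\leq \frac{1}{2}\int_{\partial\Omega}|x|^p\,d\mathcal{H}^0(x). $$ (i) If $p\geq 1$, then $(\ast)$ holds for every such $\Omega$. In case of equality, $\Omega$ must be a single interval, and if $p>1$ this interval has to be centered at the origin. (ii) If $0<p<1$, then $(\ast)$ does not hold in general, i.e. there exists such an $\Omega$ for which $(\ast)$ fails. (iii) If $p<0$, then $(\ast)$ holds for all such $\Omega$ containing the origin. In case of equality, $\Omega$ has to be a single interval centered at the origin.
   Context: $\mathcal{L}^1$ is the Lebesgue measure on $\mathbb{R}$ and $\mathcal{H}^0$ is the counting measure, so $\int_{\partial\Omega}|x|^p\,d\mathcal{H}^0(x)=\sum_{x\in\partial\Omega}|x|^p$. *)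

(* Defs.v *)
From mathcomp Require Import all_boot all_order all_algebra.
From mathcomp Require Import all_classical all_reals all_analysis.

Set Implicit Arguments.
Unset Strict Implicit.
Unset Printing Implicit Defensive.

Import Order.TTheory GRing.Theory Num.Theory.
Import numFieldNormedType.Exports.

Local Open Scope classical_set_scope.
Local Open Scope ring_scope.
Local Open Scope ereal_scope.

Definition boundary (T : topologicalType) (A : set T) : set T :=
  closure A `\` interior A.

Definition bounded_open_interval (R : realType) (J : set R) : Prop :=
  exists a b : R, (a < b)%R /\ J = `]a, b[%classic.

Definition origin_centered_interval (R : realType) (J : set R) : Prop :=
  exists r : R, (0 < r)%R /\ J = `](- r)%R, r[%classic.

Definition admissible (R : realType) (Omega : set R) : Prop :=
  Omega !=set0 /\
  exists (n : nat) (J : 'I_n -> set R),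
    [/\ forall i, bounded_open_interval (J i),
        trivIset [set: 'I_n] (fun i => closure (J i)) &
        Omega = \bigcup_i J i].

Definition half_length_pow (R : realType) (p : R) (Omega : set R) : \bar R :=
  ((2^-1)%:E * lebesgue_measure Omega) `^ p.

(* [powR] sends 0 to 0 for every nonzero exponent, also for [p < 0], where
   |0|^p should be +oo; the value at 0 is irrelevant for [p < 0] when 0 is in
   the open set [Omega], since then 0 is not in [boundary Omega].
   The counting measure is the 0-dimensional Hausdorff measure; it is taken
   on R with its Borel sigma-algebra. *)
Definition half_boundary_moment (R : realType) (p : R) (Omega : set R) :
    \bar R :=
  (2^-1)%:E *
  \int[@counting (measurableTypeR R) R]_(x in boundary Omega)
     (`|x : R| `^ p)%:E.

Definition boundary_ineq (R : realType) (p : R) (Omega : set R) : Prop :=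
  half_length_pow p Omega <= half_boundary_moment p Omega.

Definition boundary_eq (R : realType) (p : R) (Omega : set R) : Prop :=
  half_length_pow p Omega = half_boundary_moment p Omega.

(* Main.v *)
Require Import Defs.
From mathcomp Require Import all_boot all_order all_algebra.
From mathcomp Require Import all_classical all_reals all_analysis.
From mathcomp Require Import measurable_realfun.
From mathcomp Require Import ring lra.

Import Order.TTheory GRing.Theory Num.Theory.
Import numFieldNormedType.Exports.

Local Open Scope classical_set_scope.
Local Open Scope ring_scope.

(** Let [L] be the length of [Omega], and suppose that [m < M] are two boundary
    points of [Omega].  The boundary sum is at least [`|m| `^ p + `|M| `^ p],
    so all three parts concern a two-point inequality between [L / 2] and the
    mean of [`|m| `^ p] and [`|M| `^ p] ([boundary_two_points]).

    For [1 <= p] take [m] and [M] to be the infimum and supremum of [Omega].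
    Then [L <= M - m <= `|m| + `|M|], and since [x `^ p] is nondecreasing and
    convex on the nonnegative reals,
    [(L / 2) `^ p <= ((`|m| + `|M|) / 2) `^ p <= (`|m| `^ p + `|M| `^ p) / 2].
    The gap between two components of [Omega] makes [L < M - m]
    ([itvs_union_hull]), so equality forces one component; for [1 < p] strict
    convexity also forces [`|m| = `|M|], that is [m = - M].

    For [p < 0] the power is decreasing, so length has to be bounded from below
    instead: take [m < 0 < M] to be the endpoints of the component containing
    the origin.  Then [`|m| + `|M| = M - m <= L], and the same chain of
    inequalities holds.  A second component makes [L > M - m]
    ([itvs_union_component]), and strict convexity again gives [m = - M].

    For [0 < p < 1] the interval from 0 to 2 violates the inequality: the left
    side is 1, and the right side is [2 `^ p / 2 < 1]. *)

(** * Convexity of real powers *)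

(** The strict Bernoulli inequality, derived from [1 + x < expR x].  Put
    [t = expR y].  For [p < 0] the point 0 lies strictly between [y] and
    [p * y], so the tangent of [expR] at 0 is used at these two points; for
    [1 < p] it is [y] that lies between 0 and [p * y], so the tangent at [y] is
    used, which is why the inequality is applied to [(p - 1) * y] and [- y]. *)
Lemma powR_tangent_lt (R : realType) (p t : R) :
  (1 < p /\ 0 <= t) \/ (p < 0 /\ 0 < t) -> t != 1 ->
  1 + p * (t - 1) < t `^ p.
Proof.
move=> H t1; have [t0|t0] := eqVneq t 0.
  case: H => [[p1 _]|[_]]; last by rewrite t0 ltxx.
  by rewrite t0 powR0; [lra|apply/eqP; lra].
have tp : 0 < t by rewrite lt_neqAle eq_sym t0; case: H => -[_] //; exact: ltW.
have y0 : ln t != 0 by rewrite ln_eq0.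
have et : expR (ln t) = t by rewrite lnK// posrE.
rewrite /powR (negbTE t0); set y := ln t in y0 et *.
case: H => [[p1 _]|[p0 _]].
  have q : (p - 1) * y != 0 by rewrite mulf_neq0//; apply/eqP; lra.
  have := expR_gt1Dx q; rewrite mulrBl mul1r expRD expRN et.
  have := @expR_gt1Dx _ (- y); rewrite oppr_eq0 expRN et => /(_ y0) h1 h2.
  have {}h1 : t * (1 - y) < 1 by rewrite mulrC -ltr_pdivlMr// mul1r.
  have {}h2 : (1 + (p * y - y)) * t < expR (p * y) by rewrite -ltr_pdivlMr.
  have h3 : (p - 1) * (t * (1 - y)) < (p - 1) * 1 by rewrite ltr_pM2l//; lra.
  lra.
have q : p * y != 0 by rewrite mulf_neq0//; apply/eqP; lra.
have h2 := expR_gt1Dx q.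
have h1 := expR_gt1Dx y0; rewrite et in h1.
have h3 : p * t < p * (1 + y) by rewrite ltr_nM2l.
lra.
Qed.

(** Add the tangent-line bounds at the midpoint [m] for [u] and for [v],
    rescaled by homogeneity of the power; their linear terms cancel. *)
Lemma powR_midpoint_lt (R : realType) (p u v : R) :
  (1 < p /\ 0 <= u /\ 0 <= v) \/ (p < 0 /\ 0 < u /\ 0 < v) -> u != v ->
  ((u + v) / 2) `^ p < (u `^ p + v `^ p) / 2.
Proof.
move=> H uv; pose m := (u + v) / 2.
have [u0 v0] : 0 <= u /\ 0 <= v by case: H => -[_ []]; split; lra.
have m0 : 0 < m by move/eqP: uv => uv; rewrite /m; lra.
have tangent w : 0 <= w -> (p < 0 -> 0 < w) -> w != m ->
    m `^ p * (1 + p * (w / m - 1)) < w `^ p.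
  move=> w0 pw wm; have -> : w `^ p = m `^ p * (w / m) `^ p.
    rewrite -powRM ?(divr_ge0 w0 (ltW m0)) ?(ltW m0)//.
    by rewrite mulrC divfK// lt0r_neq0.
  rewrite ltr_pM2l ?powR_gt0//.
  apply: powR_tangent_lt; last first.
    by apply: contra wm => /eqP h; rewrite -(divfK (lt0r_neq0 m0) w) h mul1r.
  case: H => -[? _]; first by left; rewrite (divr_ge0 w0 (ltW m0)).
  by right; rewrite divr_gt0 ?pw.
have hu : m `^ p * (1 + p * (u / m - 1)) < u `^ p.
  apply: tangent => //; first by case: H => -[? [? ?]] //; lra.
  by apply/eqP; move/eqP: uv; rewrite /m; lra.
have hv : m `^ p * (1 + p * (v / m - 1)) < v `^ p.
  apply: tangent => //; first by case: H => -[? [? ?]] //; lra.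
  by apply/eqP; move/eqP: uv; rewrite /m; lra.
have : m `^ p * (1 + p * (u / m - 1)) + m `^ p * (1 + p * (v / m - 1)) =
       2 * m `^ p.
  have -> : v = 2 * m - u by rewrite /m; lra.
  by field; exact: lt0r_neq0.
rewrite -/m; lra.
Qed.

Lemma powR_midpoint_le (R : realType) (p u v : R) :
  (1 <= p /\ 0 <= u /\ 0 <= v) \/ (p < 0 /\ 0 < u /\ 0 < v) ->
  ((u + v) / 2) `^ p <= (u `^ p + v `^ p) / 2.
Proof.
move=> H; have [->|uv] := eqVneq u v.
  have -> : (v + v) / 2 = v by lra.
  lra.
have [p1|p1] := eqVneq p 1.
  by case: H => -[? [? ?]]; [rewrite p1 !powRr1//; lra|lra].
apply/ltW/powR_midpoint_lt => //; case: H => [[? ?]|]; [left|by right].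
by rewrite lt_neqAle eq_sym p1.
Qed.

Lemma ltr_powR_neg (R : realType) (p x y : R) :
  p < 0 -> 0 < x -> x < y -> y `^ p < x `^ p.
Proof.
move=> p0 x0 xy; have y0 : 0 < y by lra.
by rewrite /powR !gt_eqF// ltr_expR ltr_nM2l// ltr_ln.
Qed.

(** * The boundary sum *)

Lemma closure_itvoo (R : realType) (a b : R) :
  a < b -> closure `]a, b[%classic = `[a, b]%classic.
Proof.
move=> ab; have e0 : 0 < (b - a) / 2 by lra.
have := closed_ball_itv ((a + b) / 2) e0; rewrite /closed_ball ball_itv.
have -> : (a + b) / 2 - (b - a) / 2 = a by lra.
by have -> : (a + b) / 2 + (b - a) / 2 = b by lra.
Qed.

Lemma integral_counting_set1 (R : realType) (f : R -> R) (u : R) :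
  (\int[@counting (measurableTypeR R) R]_(x in [set u]) (f x)%:E = (f u)%:E)%E.
Proof.
rewrite (@eq_integral _ _ _ _ _ (cst (f u)%:E)); last first.
  by move=> x; rewrite inE => ->.
rewrite integral_cst//=.
by rewrite /counting asboolT// fset_set1 finmap.cardfs1 mule1.
Qed.

Lemma measurable_norm_powR (R : realType) (p : R) (D : set R) :
  measurable_fun (D : set (measurableTypeR R)) (fun x : R => (`|x| `^ p)%:E).
Proof.
apply: measurable_funTS; apply: measurableT_comp => //.
by apply: (measurableT_comp (measurable_powR p)).
Qed.

Lemma integral_counting_set2 (R : realType) (p u v : R) : u != v ->
  (\int[@counting (measurableTypeR R) R]_(x in [set u; v]) (`|x : R| `^ p)%:E =
   (`|u| `^ p + `|v| `^ p)%:E)%E.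
Proof.
move=> uv; rewrite ge0_integral_setU//.
- by rewrite (integral_counting_set1 _ (fun x => `|x| `^ p) u)
    (integral_counting_set1 _ (fun x => `|x| `^ p) v).
- exact: measurable_norm_powR.
- by apply/disj_set2P/seteqP; split => // x [-> /eqP]; rewrite (negbTE uv).
Qed.

Lemma half_length_powE (R : realType) (p L : R) (A : set R) :
  lebesgue_measure A = L%:E -> half_length_pow p A = ((L / 2) `^ p)%:E.
Proof. by move=> AL; rewrite /half_length_pow AL -EFinM poweR_EFin mulrC. Qed.

Lemma half_boundary_moment_ge (R : realType) (p : R) (A : set R) (u v : R) :
  boundary A u -> boundary A v -> u != v ->
  (((`|u| `^ p + `|v| `^ p) / 2)%:E <= half_boundary_moment p A)%E.
Proof.
move=> Au Av uv; rewrite mulrC EFinM -(@integral_counting_set2 _ _ _ _ uv).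
apply: lee_wpmul2l => //.
apply: ge0_subset_integral => //.
- exact: measurableU.
- apply: measurableD; first exact: (closed_measurable (@closed_closure _ A)).
  exact: (open_measurable (@open_interior _ A)).
- exact: measurable_norm_powR.
- by move=> x [->|->].
Qed.

(** * Finite unions of separated open intervals *)

(** The order-theoretic form of disjointness of the closed intervals with
    endpoints [a i] and [b i], suited to linear arithmetic. *)
Definition separated_itvs {R : realType} {n : nat} (a b : 'I_n -> R) : Prop :=
  (forall i, a i < b i) /\ (forall i j, i != j -> b i < a j \/ b j < a i).

Definition itvs_union {R : realType} {n : nat} (a b : 'I_n -> R) : set R :=
  \bigcup_i `]a i, b i[%classic.

Lemma admissible_itvs_union (R : realType) (A : set R) : admissible A ->
  exists n (a b : 'I_n -> R), separated_itvs a b /\ A = itvs_union a b.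
Proof.
move=> [_ [n [J [Jitv Jdisj ->]]]].
have [a /choice[b abJ]] := choice Jitv.
have Jab : J = fun i => `]a i, b i[%classic.
  by apply/funext => i; have [] := abJ i.
have ab i : a i < b i by have [] := abJ i.
exists n, a, b; split; last by rewrite Jab.
split => // i j /eqP ij.
have [|abji] := ltP (b i) (a j); first by left.
have [|abij] := ltP (b j) (a i); first by right.
exfalso; apply: ij; apply: Jdisj => //.
(* Two overlapping closed intervals share the larger of their left ends. *)
exists (Num.max (a i) (a j)); rewrite Jab !closure_itvoo//; split => /=;
  by rewrite in_itv/= ge_max le_max lexx ?orbT/= ?(ltW (ab _)) ?abji ?abij.
Qed.

(** Separation is what keeps an endpoint of one component from being covered by
    another component. *)
Lemma itvs_union_boundary (R : realType) (n : nat) (a b : 'I_n -> R) i x :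
  separated_itvs a b -> x = a i \/ x = b i -> boundary (itvs_union a b) x.
Proof.
move=> [ab ne] xab; have abi := ab i; split.
  have : closure `]a i, b i[%classic x.
    by rewrite closure_itvoo//= in_itv/=; case: xab => ->; rewrite lexx ltW.
  by apply: closureS => y yi; exists i.
move=> /interior_subset[k _] /=; rewrite in_itv/= => /andP[ax xb].
have abk := ab k; have [ki|/ne] := eqVneq k i; last by case: xab; lra.
by move: ax xb; rewrite ki; case: xab; lra.
Qed.

Lemma measurable_itvs_union (R : realType) (n : nat) (a b : 'I_n -> R) :
  measurable (itvs_union a b).
Proof. by apply: fin_bigcup_measurable => // i _; exact: measurable_itv. Qed.

Lemma lebesgue_measure_itvoo (R : realType) (x y : R) : x < y ->
  lebesgue_measure (`]x, y[%classic : set R) = (y - x)%:E.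
Proof. by move=> xy; rewrite lebesgue_measure_itv/= lte_fin xy. Qed.

(** Here [m] and [M] are the least left end and the greatest right end.  If the
    leftmost component is not the only one, the open interval between its right
    end and the next left end is disjoint from the union, which is therefore
    covered by two intervals of total length less than [M - m].  The index [i0]
    only witnesses that there is a component. *)
Lemma itvs_union_hull (R : realType) (n : nat) (a b : 'I_n -> R) (i0 : 'I_n) :
  separated_itvs a b -> exists m M L : R,
  [/\ m < M, boundary (itvs_union a b) m, boundary (itvs_union a b) M,
      lebesgue_measure (itvs_union a b) = L%:E &
      [/\ 0 <= L, L <= M - m & L = M - m -> itvs_union a b = `]m, M[%classic]].
Proof.
move=> sep; have [ab ne] := sep.
case: (@arg_minP _ _ _ i0 xpredT a isT) => im _ hm.
case: (@arg_maxP _ _ _ i0 xpredT b isT) => iM _ hM.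
have mM : a im < b iM by exact: le_lt_trans (hm iM isT) (ab iM).
have sub : itvs_union a b `<=` `]a im, b iM[%classic.
  move=> x [k _] /=; rewrite !in_itv/= => /andP[ax xb].
  by rewrite (le_lt_trans (hm k isT) ax) (lt_le_trans xb (hM k isT)).
have mule : (lebesgue_measure (itvs_union a b) <= (b iM - a im)%:E)%E.
  rewrite -lebesgue_measure_itvoo//; apply: le_measure => //; rewrite inE.
    exact: measurable_itvs_union.
  exact: measurable_itv.
have mufin : lebesgue_measure (itvs_union a b) \is a fin_num.
  by rewrite ge0_fin_numE// (le_lt_trans mule)// ltry.
exists (a im), (b iM), (fine (lebesgue_measure (itvs_union a b))); split => //.
- by apply: (itvs_union_boundary _ _ _ _ _ _ sep); left.
- by apply: (itvs_union_boundary _ _ _ _ _ _ sep); right.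
- by rewrite fineK.
have Lle : fine (lebesgue_measure (itvs_union a b)) <= b iM - a im.
  by rewrite -lee_fin fineK.
split => //; first by rewrite fine_ge0.
move=> Leq.
(* [im] is the leftmost component; [j] below is the next one. *)
have [/forallP one|/forallPn[k0 k0m]] := boolP [forall k, k == im].
  apply/seteqP; split => // x xin; exists im => //.
  by rewrite -[X in b X](eqP (one iM)).
exfalso.
case: (@arg_minP _ _ _ k0 (fun k => k != im) a k0m) => j jm hj.
have gap : b im < a j.
  by have := ne _ _ jm; have := hm j isT; have := ab j; have := ab im; lra.
have ajM : a j < b iM by exact: lt_le_trans (ab j) (hM j isT).
have abm := ab im.
have : (lebesgue_measure (itvs_union a b) <=
        ((b im - a im) + (b iM - a j))%:E)%E.
  rewrite EFinD -!lebesgue_measure_itvoo//.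
  apply: le_trans (measureU2 _ _ _); try exact: measurable_itv.
  apply: le_measure; rewrite ?inE.
  - exact: measurable_itvs_union.
  - by apply: measurableU; exact: measurable_itv.
  move=> x [k _] /=; rewrite !in_itv/= => /andP[ax xb].
  have [ki|km] := eqVneq k im; first by left; rewrite -ki ax xb.
  right; rewrite (le_lt_trans (hj k km) ax)/=.
  exact: lt_le_trans xb (hM k isT).
by rewrite -(fineK mufin) lee_fin; lra.
Qed.

(** A second component adds its own positive length to that of the component
    containing [x], so the length equality excludes it. *)
Lemma itvs_union_component (R : realType) (n : nat) (a b : 'I_n -> R) (x : R) :
  separated_itvs a b -> itvs_union a b x -> exists m M : R,
  [/\ m < x < M, boundary (itvs_union a b) m, boundary (itvs_union a b) M,
      ((M - m)%:E <= lebesgue_measure (itvs_union a b))%E &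
      lebesgue_measure (itvs_union a b) = (M - m)%:E ->
        itvs_union a b = `]m, M[%classic].
Proof.
move=> sep; have [ab ne] := sep.
move=> [i _] /=; rewrite in_itv/= => xi.
exists (a i), (b i); split => //.
- by apply: (itvs_union_boundary _ _ _ _ _ _ sep); left.
- by apply: (itvs_union_boundary _ _ _ _ _ _ sep); right.
- rewrite -lebesgue_measure_itvoo//.
  apply: le_measure; rewrite ?inE.
  + exact: measurable_itv.
  + exact: measurable_itvs_union.
  by move=> y yi; exists i.
move=> mueq; apply/seteqP; split; last by move=> y yi; exists i.
move=> y [j _ yj]; have [<-//|ji] := eqVneq j i; exfalso.
have abi := ab i; have abj := ab j.
have : (((b i - a i) + (b j - a j))%:E <= lebesgue_measure (itvs_union a b))%E.
  rewrite EFinD -!lebesgue_measure_itvoo//.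
  rewrite -measureU; try exact: measurable_itv.
    apply: le_measure; rewrite ?inE.
    - by apply: measurableU; exact: measurable_itv.
    - exact: measurable_itvs_union.
    by move=> z [zi|zj]; [exists i|exists j].
  apply/seteqP; split => // z /= []; rewrite !in_itv/= => /andP[? ?] /andP[? ?].
  by have := ne _ _ ji; lra.
by rewrite mueq lee_fin; lra.
Qed.

(** * The inequality and its equality cases *)

(** Reduces the inequality for [A], and the information contained in equality,
    to a statement about two real numbers. *)
Lemma boundary_two_points (R : realType) (p L u v : R) (A : set R) :
  lebesgue_measure A = L%:E -> boundary A u -> boundary A v -> u != v ->
  ((L / 2) `^ p <= (`|u| `^ p + `|v| `^ p) / 2 -> boundary_ineq p A) /\
  (boundary_eq p A -> (`|u| `^ p + `|v| `^ p) / 2 <= (L / 2) `^ p).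
Proof.
move=> AL Au Av uv; have ge := half_boundary_moment_ge _ p _ _ _ Au Av uv.
rewrite /boundary_ineq /boundary_eq (half_length_powE _ _ _ _ AL); split.
  by move=> le; apply: le_trans ge; rewrite lee_fin.
by move=> eq; rewrite -lee_fin eq.
Qed.

Lemma boundary_ineq_ge1 (R : realType) (p : R) (A : set R) :
  1 <= p -> admissible A ->
  [/\ boundary_ineq p A,
      boundary_eq p A -> bounded_open_interval A &
      boundary_eq p A -> 1 < p -> origin_centered_interval A].
Proof.
move=> p1 admA; have [[x0 Ax0] _] := admA.
have [n [a [b [sep Aab]]]] := admissible_itvs_union _ _ admA.
have [i0 _ _] : (itvs_union a b) x0 by rewrite -Aab.
have [m [M [L [mM]]]] := itvs_union_hull _ _ _ _ i0 sep.
rewrite -Aab => Am AM AL [L0 LmM Leq].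
have mneM : m != M by rewrite lt_eqF.
have [ineq eq] := boundary_two_points _ p _ _ _ _ AL Am AM mneM.
have p0 : 0 < p by lra.
have hMm : M - m <= `|m| + `|M|.
  by have := ler_norm M; have := ler_norm (- m); rewrite normrN; lra.
have le1 : (L / 2) `^ p <= ((M - m) / 2) `^ p.
  by apply: ge0_ler_powR; rewrite ?nnegrE; lra.
have le2 : ((M - m) / 2) `^ p <= ((`|m| + `|M|) / 2) `^ p.
  by apply: ge0_ler_powR; rewrite ?nnegrE; lra.
have le3 : ((`|m| + `|M|) / 2) `^ p <= (`|m| `^ p + `|M| `^ p) / 2.
  by apply: powR_midpoint_le; left.
have single : boundary_eq p A -> A = `]m, M[%classic.
  move=> /eq ge; apply: Leq; apply/eqP; rewrite eq_le LmM/= leNgt.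
  apply/negP => lt.
  have : (L / 2) `^ p < ((M - m) / 2) `^ p.
    by apply: gt0_ltr_powR; rewrite ?nnegrE; lra.
  lra.
split; first by apply: ineq; lra.
  by move=> /single ->; exists m, M.
move=> Aeq p1'.
have mM' : `|m| = `|M|.
  apply/eqP/negPn/negP => ne; have := eq Aeq.
  have : ((`|m| + `|M|) / 2) `^ p < (`|m| `^ p + `|M| `^ p) / 2.
    by apply: powR_midpoint_lt => //; left.
  lra.
have mE : m = - M.
  by apply/eqP; move/eqP: mM'; rewrite eqr_norm2 (negbTE mneM).
by exists M; split; [lra|rewrite -mE; exact: single].
Qed.

Lemma boundary_ineq_lt0 (R : realType) (p : R) (A : set R) :
  p < 0 -> admissible A -> A 0 ->
  boundary_ineq p A /\ (boundary_eq p A -> origin_centered_interval A).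
Proof.
move=> p0 admA A0.
have [n [a [b [sep Aab]]]] := admissible_itvs_union _ _ admA.
have [i0 _ _] : (itvs_union a b) 0 by rewrite -Aab.
have [? [? [L [_ _ _ AL _]]]] := itvs_union_hull _ _ _ _ i0 sep.
move: A0; rewrite Aab => /(itvs_union_component _ _ _ _ _ sep).
rewrite -Aab in AL *; move=> [m [M [/andP[m0 M0] Am AM LmM Leq]]].
rewrite AL lee_fin in LmM; rewrite AL in Leq.
have mneM : m != M by rewrite lt_eqF//; lra.
have [ineq eq] := boundary_two_points _ p _ _ _ _ AL Am AM mneM.
have nm : `|m| = - m by rewrite ltr0_norm.
have nM : `|M| = M by rewrite gtr0_norm.
rewrite nm nM in ineq eq.
have lt1 : M - m < L -> (L / 2) `^ p < ((- m + M) / 2) `^ p.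
  by move=> lt; apply: ltr_powR_neg; lra.
have le1 : (L / 2) `^ p <= ((- m + M) / 2) `^ p.
  move: LmM; rewrite le_eqVlt => /predU1P[<-|/lt1/ltW//].
  by rewrite addrC.
have le2 : ((- m + M) / 2) `^ p <= ((- m) `^ p + M `^ p) / 2.
  by apply: powR_midpoint_le; right; lra.
split; first by apply: ineq; lra.
move=> /eq ge.
have LE : L = M - m.
  by apply/eqP; rewrite eq_le LmM andbT leNgt; apply/negP => /lt1; lra.
have mE : m = - M.
  apply/eqP/negPn/negP => ne.
  have : ((- m + M) / 2) `^ p < ((- m) `^ p + M `^ p) / 2.
    apply: powR_midpoint_lt; first by right; lra.
    by rewrite eqr_oppLR.
  lra.
by exists M; split=> //; rewrite -mE; apply: Leq; rewrite LE.
Qed.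

Lemma boundary_ineq_fails (R : realType) (p : R) : 0 < p < 1 ->
  exists A : set R, admissible A /\ ~ boundary_ineq p A.
Proof.
move=> /andP[p0 p1]; have lt02 : (0 : R) < 2 by [].
exists `]0, 2[%classic; split.
  split; first by exists 1; rewrite /= in_itv/=; lra.
  exists 1, (fun=> `]0, 2[%classic); split.
  - by move=> _; exists 0, 2.
  - by move=> i j _ _ _; rewrite !ord1.
  - apply/seteqP; split => x; first by exists ord0.
    by move=> [].
have bd : boundary (`]0, 2[%classic : set R) = [set 0; 2 : R].
  rewrite /boundary closure_itvoo// interior_itv_bnd.
  apply/seteqP; split => x /=; rewrite !in_itv/=.
    move=> [/andP[x0 x2] /negP]; rewrite negb_and -!leNgt => /orP[|]; lra.
  by move=> [->|->]; split; lra.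
have A2 : lebesgue_measure (`]0, 2[%classic : set R) = 2%:E.
  by rewrite lebesgue_measure_itvoo// subr0.
rewrite /boundary_ineq (half_length_powE _ _ _ _ A2) /half_boundary_moment bd.
rewrite integral_counting_set2 ?lt_eqF// -EFinM lee_fin divff// powR1.
rewrite normr0 (gtr0_norm lt02) powR0 ?gt_eqF// add0r.
have : 2 `^ p < 2 :> R.
  rewrite /powR gt_eqF// -[ltRHS](lnK (x := 2))// ltr_expR.
  by rewrite gtr_pMl// ln_gt0//; lra.
lra.
Qed.

Theorem proposition1 (R : realType) (p : R) :
  [/\ 1 <= p ->
        forall Omega : set R, admissible Omega ->
          [/\ boundary_ineq p Omega,
              boundary_eq p Omega -> bounded_open_interval Omega &
              boundary_eq p Omega -> 1 < p -> origin_centered_interval Omega],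
      0 < p < 1 ->
        exists Omega : set R, admissible Omega /\ ~ boundary_ineq p Omega &
      p < 0 ->
        forall Omega : set R, admissible Omega -> Omega 0 ->
          boundary_ineq p Omega /\
          (boundary_eq p Omega -> origin_centered_interval Omega)].
Proof.
split; first by move=> p1 A; exact: boundary_ineq_ge1.
  exact: boundary_ineq_fails.
by move=> p0 A; exact: boundary_ineq_lt0.
Qed.
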